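(* For integers $k \ge 1$ and $n \ge 1$, let $\mathcal{C}_{k,n}$ be the family of all graphs on a fixed vertex set $V$ of size $n$ having clique-width at most $k$. Then $\mathcal{C}_{k,n}$ has an adjacency labeling scheme of size $O(k \log k \log n)$; that is, there is an absolute constant $C > 0$ such that for all $k, n \ge 1$ there is an $L$-bit adjacency labeling scheme for $\mathcal{C}_{k,n}$ with $L \le C\, k \log_2 k \, \log_2 n$. Moreover, if $k$ is bounded, this is optimal up to a constant factor: for every $K \ge 1$ there is a constant $c_K > 0$ such that for all $1 \le k \le K$ and all $n \ge 1$, every $L$-bit adjacency labeling scheme for $\mathcal{C}_{k,n}$ satisfies $L \ge c_K\, k \log_2 k\, \log_2 n$.
   Context: All graphs are finite, undirected, without self-loops or parallel edges. For a graph $G=(V,E)$ and $u,v \in V$, put $\mathsf{adj}(u,v) = 1$ if $\{u,v\}\in E$ and $\mathsf{adj}(u,v)=0$ otherwise. Adjacency labeling scheme: let $\mathcal{F}_n$ be a family of graphs on the vertex set $V$, $|V| = n$. An $L$-bit adjacency labeling scheme of $\mathcal{F}_n$ is a pair of functions $\mathsf{enc}: \mathcal{F}_n \to (V \to \{0,1\}^L)$ and $\mathsf{dec}: \{0,1\}^L \times \{0,1\}^L \to \{0,1\}$ such that for all $G = (V,E)\in \mathcal{F}_n$ and all $u,v\in V$, $\mathsf{adj}(u,v) = \mathsf{dec}(\mathsf{enc}(G)(u), \mathsf{enc}(G)(v))$. (So $\mathsf{dec}$ may depend on the family, but not on the individual graph $G$.) Clique-width: the clique-width of a graph $G$ is the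 minimum number of vertex labels needed to construct $G$ using the following four operations on vertex-labeled graphs: (1) create a single vertex $v$ with label $i$; (2) disjoint union $G_1 \oplus G_2$ of two labeled graphs; (3) join $\eta_{i,j}$ with $i\neq j$, which adds an edge between every pair of vertices one of which has label $i$ and the other label $j$; (4) relabel $\rho_{i\to j}$, which changes the label of all vertices with label $i$ to label $j$. *)

(* Defs.v *)
From mathcomp Require Import all_boot all_order all_algebra.
From mathcomp Require Import boolp reals exp.

Set Implicit Arguments.
Unset Strict Implicit.
Unset Printing Implicit Defensive.

Record sgraph (V : finType) := SGraph {
  adj :> rel V;
  adj_sym : symmetric adj;
  adj_irr : irreflexive adj
}.

(* A graph on the vertex set [lvert] (a subset of V) whose vertices carry labels
   from a set of k labels.  The values of [llab] outside [lvert] are meaningless;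
   for the graphs built below, [ladj] only relates elements of [lvert]. *)
Record lgraph (V : finType) (k : nat) := LGraph {
  lvert : {set V};
  ladj : rel V;
  llab : V -> 'I_k
}.

Section Operations.
Variables (V : finType) (k : nat).
Implicit Types (H : lgraph V k) (i j : 'I_k).

Definition lg_vertex (v : V) i : lgraph V k :=
  LGraph [set v] (fun _ _ => false) (fun _ => i).

(* Meant for vertex-disjoint H1 and H2. *)
Definition lg_union H1 H2 : lgraph V k :=
  LGraph (lvert H1 :|: lvert H2)
         (fun u v => ladj H1 u v || ladj H2 u v)
         (fun u => if u \in lvert H1 then llab H1 u else llab H2 u).

Definition lg_join i j H : lgraph V k :=
  LGraph (lvert H)
         (fun u v => ladj H u v ||
            [&& u \in lvert H, v \in lvert H
              & (llab H u == i) && (llab H v == j)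
                || (llab H u == j) && (llab H v == i)])
         (llab H).

Definition lg_relabel i j H : lgraph V k :=
  LGraph (lvert H) (ladj H)
         (fun u => if llab H u == i then j else llab H u).

Inductive cw_built : lgraph V k -> Prop :=
| CwVertex v i : cw_built (lg_vertex v i)
| CwUnion H1 H2 : [disjoint lvert H1 & lvert H2] ->
    cw_built H1 -> cw_built H2 -> cw_built (lg_union H1 H2)
| CwJoin i j H : i != j -> cw_built H -> cw_built (lg_join i j H)
| CwRelabel i j H : cw_built H -> cw_built (lg_relabel i j H).

End Operations.

Definition cw_constructible (V : finType) (G : sgraph V) (k : nat) : Prop :=
  exists H : lgraph V k,
    [/\ cw_built H, lvert H = [set: V] & forall u v, ladj H u v = G u v].

Definition cw_constructibleb (V : finType) (G : sgraph V) : pred nat :=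
  fun k => `[< cw_constructible G k >].

(* The least number of labels with which G can be constructed.  The operations
   never produce the graph without vertices, whose clique-width is set to 0; by
   [cw_constructible_card] this is the only graph for which the default is used. *)
Definition clique_width (V : finType) (G : sgraph V) : nat :=
  match pselect (exists k, cw_constructibleb G k) with
  | left ex => ex_minn ex
  | right _ => 0
  end.

Definition graph_family (V : finType) := sgraph V -> Prop.

Definition cw_family (V : finType) (k : nat) : graph_family V :=
  fun G => clique_width G <= k.
Arguments cw_family V k G : clear implicits.

Definition is_labeling_scheme (V : finType) (F : graph_family V) (L : nat)
    (enc : {G : sgraph V | F G} -> V -> L.-tuple bool)
    (dec : L.-tuple bool * L.-tuple bool -> bool) : Prop :=
  forall (G : {G : sgraph V | F G}) (u v : V),
    adj (sval G) u v = dec (enc G u, enc G v).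

Definition log2 (R : realType) (x : R) : R := (ln x / ln 2)%R.

Lemma cw_constructible_card (V : finType) (G : sgraph V) :
  0 < #|V| -> cw_constructible G #|V|.
Proof.
move=> V_gt0.
have edgeless (s : seq V) : s != [::] -> uniq s ->
    exists H : lgraph V #|V|,
    [/\ cw_built H, lvert H = [set x in s], forall u v, ladj H u v = false
      & forall u, u \in s -> llab H u = enum_rank u].
  elim: s => [|x [|y s] IHs] // _ /andP[xs us].
    exists (lg_vertex x (enum_rank x)); split => //=.
    - exact: CwVertex.
    - by apply/setP=> u; rewrite !inE.
    - by move=> u; rewrite inE => /eqP->.
  have [H [bH vH eH lH]] := IHs isT us.
  exists (lg_union (lg_vertex x (enum_rank x)) H); split => //=.
  - apply: CwUnion (CwVertex _ _) bH.
    by rewrite vH disjoints1 inE.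
  - by rewrite vH; apply/setP=> u; rewrite !inE.
  - move=> u; rewrite in_set1 inE => /orP[/eqP->|us'].
      by rewrite eqxx.
    by case: eqP => [->//|_]; apply: lH.
have edges (s : seq (V * V)) : all (fun p => p.1 != p.2) s ->
    exists H : lgraph V #|V|,
    [/\ cw_built H, lvert H = [set: V],
        forall u v, ladj H u v = ((u, v) \in s) || ((v, u) \in s)
      & forall u, llab H u = enum_rank u].
  elim: s => [_|[x y] s IHs /andP[/= xy /IHs[H [bH vH eH lH]]]].
    have enumV_neq0 : enum V != [::] by rewrite -size_eq0 -cardE -lt0n.
    have [H [bH vH eH lH]] := edgeless _ enumV_neq0 (enum_uniq V).
    exists H; split => //.
    - by rewrite vH; apply/setP=> u; rewrite !inE mem_enum.
    - by move=> u; apply: lH; rewrite mem_enum.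
  exists (lg_join (enum_rank x) (enum_rank y) H); split => //=.
    by apply: CwJoin => //; rewrite (inj_eq enum_rank_inj).
  move=> u v; rewrite eH !lH vH !inE /= !(inj_eq enum_rank_inj) !xpair_eqE.
  rewrite (andbC (v == x)).
  by case: (_ && _); case: (_ && _); rewrite /= ?orbT ?orbF.
have [|H [bH vH eH _]] := edges [seq p <- enum {: V * V} | G p.1 p.2].
  apply/allP=> -[x y]; rewrite mem_filter => /andP[/= xy _].
  by apply: contraTneq xy => ->; rewrite adj_irr.
exists H; split => // u v.
by rewrite eH mem_filter mem_enum mem_filter mem_enum /= !andbT [G v u]adj_sym orbb.
Qed.

Lemma clique_widthP (V : finType) (G : sgraph V) : 0 < #|V| ->
  cw_constructible G (clique_width G) /\
  forall k, cw_constructible G k -> clique_width G <= k.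
Proof.
move=> V_gt0; rewrite /clique_width; case: pselect => [ex|[]].
  by case: ex_minnP => w /asboolP cw min_w; split=> // k /asboolP/min_w.
by exists #|V|; apply/asboolP/cw_constructible_card.
Qed.

(* Main.v *)
Require Import Defs.
From mathcomp Require Import all_boot all_order all_algebra.
From mathcomp Require Import boolp reals exp.
From mathcomp Require Import zify.
Import Order.TTheory GRing.Theory Num.Theory.

(** A clique-width expression with k labels has a subexpression whose vertex set
    X contains between one third and two thirds of any prescribed vertex set S.
    Vertices of X with the same label in that subexpression have the same
    neighbours outside X, so the edges between X and its complement are recorded
    by giving each vertex of X its label and each vertex outside X the set of
    labels it is adjacent to.  Recursing on S :&: X and S :\: X takes O(log n)
    levels of k + 1 bits each.  Conversely, a labeling of a complete graph is
    injective (equal labels at u and v give adj u v = adj u u), and complete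
    graphs have clique-width at most 2, whence 2 ^ L >= n as soon as k >= 2. *)

(** * Balanced cuts of clique-width expressions *)

Lemma ladj_lvert (V : finType) (k : nat) (H : lgraph V k) :
  cw_built H -> forall u v, ladj H u v -> (u \in lvert H) && (v \in lvert H).
Proof.
elim=> //= [H1 H2 _ _ IH1 _ IH2|i j H' _ _ IH] u v.
  by case/orP=> [/IH1|/IH2] /andP[uH vH]; rewrite !inE uH vH ?orbT.
by case/orP=> [/IH//|/and3P[-> -> _]].
Qed.

Lemma ladj_notin (V : finType) (k : nat) (H : lgraph V k) (u v : V) :
  cw_built H -> u \notin lvert H -> ladj H u v = false.
Proof. by move=> bH /negPf uH; apply/negP=> /(ladj_lvert _ _ _ bH); rewrite uH. Qed.

(** Descend while one side of a union holds more than [m] points of [S]; the descent ends at a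
    single vertex or at a union of two sides with at most [m] points each. Labels equal there stay
    equal under later operations, which treat such vertices alike. The equality of [llab H] is
    carried along for the join case. *)
Lemma balanced_cut (V : finType) (k : nat) (H : lgraph V k) (S : {set V}) (m : nat) :
  cw_built H -> m < #|S :&: lvert H| ->
  exists (X : {set V}) (t : V -> 'I_k),
    [/\ m < #|S :&: X| <= maxn 1 m.*2, X \subset lvert H
      & {in X &, forall u u', t u = t u' -> llab H u = llab H u' /\
          forall v, v \notin X -> ladj H u v = ladj H u' v}].
Proof.
move=> bH; elim: bH => [v i|H1 H2 dis b1 IH1 b2 IH2|i j H' _ _ IH|i j H' _ IH] /=.
- move=> ltm; exists [set v], (fun=> i); split=> //.
  rewrite ltm (leq_trans (subset_leq_card (subsetIr _ _))) // cards1.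
  exact: leq_maxl.
- have notin2 u : u \in lvert H1 -> u \in lvert H2 = false.
    by move=> uH; apply: (disjointFr dis).
  have notin1 u : u \in lvert H2 -> u \in lvert H1 = false.
    by move=> uH; apply: (disjointFl dis).
  move=> ltm.
  have [/IH1[X [t [cX sX tX]]]|le1] := ltnP m #|S :&: lvert H1|.
    exists X, t; split=> //; first by rewrite subsetU ?sX.
    move=> u u' uX u'X /(tX _ _ uX u'X)[lab nb].
    have uH := subsetP sX _ uX; have u'H := subsetP sX _ u'X.
    rewrite uH u'H; split=> // v vX.
    by rewrite (nb v vX) !(ladj_notin _ _ H2) ?notin2.
  have [/IH2[X [t [cX sX tX]]]|le2] := ltnP m #|S :&: lvert H2|.
    exists X, t; split=> //; first by rewrite subsetU ?sX ?orbT.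
    move=> u u' uX u'X /(tX _ _ uX u'X)[lab nb].
    have uH := subsetP sX _ uX; have u'H := subsetP sX _ u'X.
    rewrite !notin1 //; split=> // v vX.
    by rewrite (nb v vX) !(ladj_notin _ _ H1) ?notin1.
  (* Neither side exceeds [m]: the whole union is the cut, and no edge leaves it yet. *)
  exists (lvert H1 :|: lvert H2), (llab (lg_union H1 H2)); split=> //.
    rewrite ltm setIUr /=; apply: leq_trans (leq_maxr _ _).
    by rewrite -addnn (leq_trans (leq_card_setU _ _)) // leq_add.
  move=> u u' _ _ eqt; split=> // v vH.
  have adjv w : ladj (lg_union H1 H2) w v = false.
    apply/negP=> /(ladj_lvert _ _ _ (CwUnion dis b1 b2)).
    by rewrite /= (negPf vH) andbF.
  by move: (adjv u) (adjv u') => /= -> ->.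
- move=> /IH[X [t [cX sX tX]]]; exists X, t; split=> // u u' uX u'X.
  move=> /(tX _ _ uX u'X)[lab nb]; split=> // v vX.
  by rewrite lab nb // (subsetP sX _ uX) (subsetP sX _ u'X).
- move=> /IH[X [t [cX sX tX]]]; exists X, t; split=> // u u' uX u'X.
  by move=> /(tX _ _ uX u'X)[-> nb].
Qed.

Lemma ladj_cw1 (V : finType) (k : nat) (H : lgraph V k) (u v : V) :
  k <= 1 -> cw_built H -> ladj H u v = false.
Proof.
move=> lek1; elim=> //= [H1 H2 _ _ -> _ -> //|i j H' ne_ij].
suff eq_ij : i = j by rewrite eq_ij eqxx in ne_ij.
by apply: val_inj => /=; have := ltn_ord i; have := ltn_ord j; lia.
Qed.

(** * Labels from recursive cuts *)

(** One entry per cut: [(true, [set i])] for a vertex labelled [i] on the side X of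
    the cut, [(false, A)] for a vertex on the other side whose neighbours in X are
    the ones with label in [A]. *)
Fixpoint cut_decode (k : nat) (x y : seq (bool * {set 'I_k})) : bool :=
  match x, y with
  | (a, A) :: x', (b, B) :: y' =>
      if a == b then cut_decode k x' y' else A :&: B != set0
  | _, _ => false
  end.

Lemma cut_decode_id (k : nat) (x : seq (bool * {set 'I_k})) : cut_decode k x x = false.
Proof. by elim: x => [|[a A] x IHx] //=; rewrite eqxx. Qed.

Definition has_balanced_cuts (V : finType) (k : nat) (G : sgraph V) : Prop :=
  forall S : {set V}, 1 < #|S| ->
  exists (X : {set V}) (t : V -> 'I_k),
    [/\ 3 * #|S :&: X| <= 2 * #|S|, 3 * #|S :\: X| <= 2 * #|S|
      & {in X &, forall u u', t u = t u' -> forall v, v \notin X -> G u v = G u' v}].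

Lemma cw_family_balanced_cuts (V : finType) (k : nat) (G : sgraph V) :
  0 < #|V| -> cw_family V k G -> has_balanced_cuts V k G.
Proof.
move=> V_gt0 lek S S_gt1.
have [[H [bH vH eH]] _] := clique_widthP G V_gt0.
(* With [m] the floor of a third of [#|S|], more than [m] points inside [X] leave at most two thirds
   outside. *)
have [|X [t [/andP[gtX leX] _ tX]]] := balanced_cut _ _ H S (#|S| %/ 3) bH.
  by rewrite vH setIT; lia.
exists X, (fun u => widen_ord lek (t u)); have := cardsID X S.
split; [lia | lia | move=> u u' uX u'X eqt v vX].
have [|_ nb] := tX u u' uX u'X; last by rewrite -!eH nb.
by apply: val_inj; have /= := congr1 val eqt.
Qed.

(** The hypothesis says that [#|S|] is below 2 times (3/2)^d: [d] cuts, each keeping at most two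
    thirds, leave at most one vertex. *)
Lemma cut_labeling (V : finType) (k : nat) (G : sgraph V) :
  has_balanced_cuts V k G -> forall (d : nat) (S : {set V}),
  2 ^ d * #|S| < 2 * 3 ^ d ->
  exists e : V -> d.-tuple (bool * {set 'I_k}),
    {in S &, forall u v, G u v = cut_decode k (e u) (e v)}.
Proof.
move=> cuts; elim=> [|d IHd] S ltS.
  exists (fun=> [tuple]) => u v uS vS /=.
  have /card_le1_eqP/(_ u v uS vS)-> : #|S| <= 1 by move: ltS; rewrite !expn0; lia.
  exact: adj_irr.
have [/card_le1_eqP S_le1|/cuts[X [t [leI leD tX]]]] := leqP #|S| 1.
  (* Padding for a branch that ends early: equal labels decode to false. *)
  exists (fun=> nseq_tuple d.+1 (true, set0)) => u v uS vS.
  by rewrite (S_le1 u v uS vS) cut_decode_id adj_irr.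
rewrite !expnS in ltS.
have [|eI adjI] := IHd (S :&: X); first by nia.
have [|eD adjD] := IHd (S :\: X); first by nia.
pose nbr v := [set i | [exists u in X, (t u == i) && G u v]].
pose e v := if v \in X then [tuple of (true, [set t v]) :: eI v]
            else [tuple of (false, nbr v) :: eD v].
(* By [tX], a class of [t] with one neighbour of [v] consists of neighbours of [v]. *)
have cross u v : u \in X -> v \notin X -> ([set t u] :&: nbr v != set0) = G u v.
  move=> uX vX; apply/set0Pn/idP=> [[i]|Guv].
    rewrite !inE => /andP[/eqP-> /exists_inP[u' u'X /andP[/eqP eqt Gu'v]]].
    by rewrite (tX u u').
  exists (t u); rewrite !inE eqxx; apply/exists_inP; exists u => //.
  by rewrite eqxx.
exists e => u v uS vS; rewrite /e.
case: (boolP (u \in X)) (boolP (v \in X)) => uX [] vX /=.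
- by apply: adjI; rewrite inE ?uS ?vS.
- by rewrite cross.
- by rewrite setIC cross // adj_sym.
- by apply: adjD; rewrite inE ?uX ?vX.
Qed.

Lemma labeling_scheme_of_finType (V T : finType) (F : graph_family V) (L : nat)
    (D : T -> T -> bool) :
  #|T| <= 2 ^ L ->
  (forall G, F G -> exists e : V -> T, forall u v, G u v = D (e u) (e v)) ->
  exists (enc : {G : sgraph V | F G} -> V -> L.-tuple bool)
         (dec : L.-tuple bool * L.-tuple bool -> bool),
    is_labeling_scheme enc dec.
Proof.
move=> leT ex.
have leT' : #|T| <= #|{: L.-tuple bool}| by rewrite card_tuple card_bool.
pose f (x : T) : L.-tuple bool := enum_val (widen_ord leT' (enum_rank x)).
have f_inj : injective f.
  by move=> x y /enum_val_inj/(congr1 val)/= /val_inj/enum_rank_inj.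
have /choice[e eP] (G : {G : sgraph V | F G}) :
  exists e : V -> T, forall u v, sval G u v = D (e u) (e v) by apply: ex (svalP G).
exists (fun G u => f (e G u)).
(* The decoder searches for preimages under [f], as some bit strings may be no code. *)
exists (fun p => [exists x, exists y, [&& f x == p.1, f y == p.2 & D x y]]).
move=> G u v; rewrite eP; apply/idP/existsP => [Duv|[x /existsP[y /=]]].
  by exists (e G u); apply/existsP; exists (e G v); rewrite !eqxx.
by rewrite !(inj_eq f_inj) => /and3P[/eqP-> /eqP->].
Qed.

Lemma cut_labeling_scheme (V : finType) (k : nat) : 0 < #|V| ->
  let L := k.+1 * (2 * trunc_log 2 #|V|) in
  exists (enc : {G : sgraph V | cw_family V k G} -> V -> L.-tuple bool)
         (dec : L.-tuple bool * L.-tuple bool -> bool),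
    is_labeling_scheme enc dec.
Proof.
move=> V_gt0; set a := trunc_log _ _.
apply: (labeling_scheme_of_finType V ((2 * a).-tuple (bool * {set 'I_k})) _ _
  (fun x y => cut_decode k x y)).
  rewrite card_tuple card_prod card_bool -[#|{set _}|]cardsT -powersetT.
  by rewrite card_powerset cardsT card_ord -expnS -expnM.
move=> G /(cw_family_balanced_cuts _ _ _ V_gt0)/cut_labeling cutG.
have [|e eP] := cutG (2 * a) [set: V]; last by exists e => u v; apply: eP; rewrite inE.
have := trunc_log_ltn #|V| (isT : 1 < 2); rewrite -/a cardsT !expnM expnS => ltV.
(* Depth [2 * a] suffices since [#|V| < 2 * 2 ^ a] and [8 ^ a <= 9 ^ a]. *)
apply: (@leq_trans (4 ^ a * (2 * 2 ^ a))); first by rewrite ltn_pmul2l ?expn_gt0.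
by rewrite mulnCA leq_pmul2l // -expnMn; case: (a) => // b; rewrite leq_exp2r.
Qed.

(** * Lower bound from complete graphs *)

Definition complete_graph (V : finType) : sgraph V :=
  @SGraph V (fun u v => u != v) (fun u v => congr1 negb (eq_sym u v))
    (fun u => congr1 negb (eqxx u)).

Lemma cw_complete_graph (V : finType) (k : nat) :
  0 < #|V| -> 1 < k -> cw_family V k (complete_graph V).
Proof.
move=> V_gt0 k_gt1; apply: leq_trans k_gt1; apply: (clique_widthP _ V_gt0).2.
have build (s : seq V) : s != [::] -> uniq s ->
    exists H : lgraph V 2,
    [/\ cw_built H, lvert H = [set x in s],
        forall u v, ladj H u v = [&& u \in s, v \in s & u != v]
      & forall u, u \in s -> llab H u = ord0].
  elim: s => [|x [|y s] IHs] // _ /andP[xs us].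
    exists (lg_vertex x ord0); split=> //=.
    - exact: CwVertex.
    - by apply/setP=> u; rewrite !inE.
    - move=> u v; rewrite !inE.
      by case: (u =P x) (v =P x) => [->|//] [->|//]; rewrite eqxx.
  have [H [bH vH eH lH]] := IHs isT us.
  move: {y s IHs us}(y :: s) xs vH eH lH => s xs vH eH lH.
  (* The new vertex enters with the second label, is joined to all earlier ones, then takes their
     label. *)
  exists (lg_relabel ord_max ord0 (lg_join ord0 ord_max
           (lg_union (lg_vertex x ord_max) H))); split.
  - apply/CwRelabel/CwJoin=> //; apply: CwUnion (CwVertex _ _) bH.
    by rewrite vH disjoints1 inE.
  - by rewrite /= vH; apply/setP=> u; rewrite !inE.
  - move=> u v; rewrite /= eH vH !inE.
    case: (eqVneq u x) (eqVneq v x) => [->|ux] [->|vx] /=.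
    + by rewrite (negPf xs).
    + rewrite (negPf xs) /=.
      by case: (boolP (v \in s)) => //= /lH->.
    + rewrite (negPf xs) ux /= andbF.
      by case: (boolP (u \in s)) => //= /lH->.
    + by case: (boolP (u \in s)) (boolP (v \in s)) => [/lH->|_] [/lH->|_]; rewrite ?orbF.
  - move=> u; rewrite /= inE in_cons.
    by case: eqP => [_ _|_ /= /lH->]; rewrite ?eqxx.
have enumV_neq0 : enum V != [::] by rewrite -size_eq0 -cardE -lt0n.
have [H [bH vH eH _]] := build _ enumV_neq0 (enum_uniq V).
exists H; split=> // [|u v]; last by rewrite eH !mem_enum.
by rewrite vH; apply/setP=> u; rewrite !inE mem_enum.
Qed.

Lemma labeling_scheme_card (V : finType) (k L : nat)
    (enc : {G : sgraph V | cw_family V k G} -> V -> L.-tuple bool)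
    (dec : L.-tuple bool * L.-tuple bool -> bool) :
  0 < #|V| -> 1 < k -> is_labeling_scheme enc dec -> #|V| <= 2 ^ L.
Proof.
move=> V_gt0 k_gt1 scheme.
pose G : {G : sgraph V | cw_family V k G} :=
  exist _ _ (cw_complete_graph V k V_gt0 k_gt1).
have enc_inj : injective (enc G).
  move=> u v eq_uv; apply/eqP/negPn.
  by have /= -> := scheme G u v; rewrite -eq_uv -scheme /= eqxx.
by have := leq_card _ enc_inj; rewrite card_tuple card_bool.
Qed.

(** * Binary logarithms and the final estimates *)

Lemma ln2_gt0 (R : realType) : (0 < ln 2 :> R)%R.
Proof. by rewrite ln_gt0 // ltr1n. Qed.

Lemma log2_ge0 (R : realType) (n : nat) : 0 < n -> (0 <= log2 (n%:R : R))%R.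
Proof. by move=> n_gt0; rewrite divr_ge0 ?ln_ge0 ?ler1n ?(ltW (ln2_gt0 R)). Qed.

Lemma log2_le (R : realType) (m n : nat) :
  0 < m -> m <= n -> (log2 (m%:R : R) <= log2 (n%:R : R))%R.
Proof.
move=> m_gt0 lemn; rewrite ler_pM2r ?invr_gt0 ?ln2_gt0 //.
by rewrite ler_ln ?posrE ?ltr0n ?ler_nat // (leq_trans m_gt0).
Qed.

Lemma log2_expn (R : realType) (a : nat) : log2 ((2 ^ a)%:R : R) = a%:R%R.
Proof.
rewrite /log2 natrX lnXn ?ltr0n // -[(_ *+ a)%R]mulr_natr mulrAC divff ?mul1r //.
by rewrite gt_eqF ?ln2_gt0.
Qed.

Theorem theorem1 (R : realType) :
  (exists C : R, (0 < C)%R /\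
    forall (k n : nat) (V : finType), 1 <= k -> 1 <= n -> #|V| = n ->
    exists L : nat,
      (L%:R <= C * k%:R * log2 (k%:R : R) * log2 (n%:R : R))%R /\
      exists (enc : {G : sgraph V | cw_family V k G} -> V -> L.-tuple bool)
             (dec : L.-tuple bool * L.-tuple bool -> bool),
        is_labeling_scheme enc dec)
  /\
  (forall K : nat, 1 <= K ->
    exists c : R, (0 < c)%R /\
    forall (k n : nat) (V : finType), 1 <= k -> k <= K -> 1 <= n -> #|V| = n ->
    forall (L : nat)
      (enc : {G : sgraph V | cw_family V k G} -> V -> L.-tuple bool)
      (dec : L.-tuple bool * L.-tuple bool -> bool),
      is_labeling_scheme enc dec ->
      (c * k%:R * log2 (k%:R : R) * log2 (n%:R : R) <= L%:R)%R).
Proof.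
split.
  (* For [k >= 2], [k.+1 * 2 <= 4 * k] and [log2 k >= 1]. *)
  exists 4%R; split=> [|k n V k_ge1 n_ge1 cardV]; first exact: ltr0n.
  have V_gt0 : 0 < #|V| by rewrite cardV.
  move: k_ge1; rewrite leq_eqVlt => /predU1P[<-|k_gt1].
    (* For [k = 1] the bound is 0, and the graphs are edgeless. *)
    exists 0; rewrite /log2 ln1 mul0r mulr0 mul0r; split=> //.
    apply: (labeling_scheme_of_finType V unit _ _ (fun _ _ => false)).
      by rewrite card_unit.
    move=> G famG; exists (fun=> tt) => u v.
    have [[H [bH _ eH]] _] := clique_widthP G V_gt0.
    by rewrite -eH (ladj_cw1 _ _ _ _ _ famG).
  exists (k.+1 * (2 * trunc_log 2 #|V|)); split; last exact: cut_labeling_scheme.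
  have log_ge1 : (1 <= log2 (k%:R : R))%R.
    by rewrite -[leLHS](log2_expn R 1) log2_le.
  have log_ge : ((trunc_log 2 #|V|)%:R <= log2 (n%:R : R))%R.
    by rewrite -[leLHS]log2_expn log2_le ?expn_gt0 // -cardV trunc_logP.
  apply: (@le_trans _ _ (4 * k%:R * 1 * (trunc_log 2 #|V|)%:R)%R).
    by rewrite mulr1 -!natrM ler_nat; nia.
  by rewrite ler_pM ?ler_wpM2l ?mulr_ge0.
move=> K K_ge1.
have logK := log2_ge0 R K K_ge1.
have Kl_ge0 : (0 <= K%:R * log2 (K%:R : R))%R by rewrite mulr_ge0.
(* This makes [c * k * log2 k] at most 1, reducing the claim to [log2 n <= L]; the summand 1 keeps
   the denominator positive at [K = 1]. *)
exists (K%:R * log2 (K%:R : R) + 1)^-1%R; split; first by rewrite invr_gt0 ltr_wpDl.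
move=> k n V k_ge1 lekK n_ge1 cardV L enc dec scheme.
move: (k_ge1); rewrite leq_eqVlt => /predU1P[<-|k_gt1].
  by rewrite /log2 ln1 mul0r mulr0 mul0r.
have leL : (log2 (n%:R : R) <= L%:R)%R.
  rewrite -(log2_expn R L) log2_le // -cardV.
  by apply: (labeling_scheme_card V k L enc dec) => //; rewrite cardV.
apply: le_trans leL; rewrite -[leRHS]mul1r ler_wpM2r ?log2_ge0 //.
rewrite -mulrA mulrC ler_pdivrMr ?mul1r ?ltr_wpDl //.
rewrite (@le_trans _ _ (K%:R * log2 (K%:R : R))%R) ?lerDl //.
by rewrite ler_pM ?log2_ge0 ?log2_le ?ler_nat.
Qed.
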